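(* Let $S$, $\Pi_1$, $U$, $sw$, $U_T$, $\mathbf{W}$, $\mathcal{P}$, $I$ and $M(S)$ be as in the context, and suppose that $|\Pi_1|$ is odd and $|\Pi_1|\in\{1,\,n-2,\,n-1\}$. Let $odd$ denote the set of odd integers in $\{1,\dots,n\}$. Then the nontrivial orbits of $F_2^n$ under $\mathbf{W}$ are: <ul> <li>$U_{\{i,n+1-i\}}$ for $1\le i\le\lceil n/2\rceil$, if $|\Pi_1|=1$;</li> <li>$U_{odd}$ and $U_{\{2j\}}$ for $1\le j\le (n-1)/2$, if $|\Pi_1|=n-2$;</li> <li>$U_{\{2i-1,2i\}}$ for $1\le i\le\lceil n/2\rceil$, if $|\Pi_1|=n-1$.</li> </ul> (Some listed sets may coincide.) In particular, the number of orbits (including the trivial one) is $$|\mathcal{P}|=\begin{cases}\lceil (n+2)/2\rceil, & \text{if } |\Pi_1|=1;\\ (n+3)/2, & \text{if } |\Pi_1|=n-2;\\ (n+2)/2, & \text{if } |\Pi_1|=n-1.\end{cases}$$ Moreover $M(S)\le 2$, and $M(S)=1$ if and only if: <ul> <li>if $|\Pi_1|=1$: $\{i,n+1-i\}\cap I\neq\emptyset$ for all $1\le i\le\lceil n/2\rceil$;</li> <li>if $|\Pi_1|=n-2$: $odd\cap I\neq\emptyset$, and $2j\in I$ for all $1\le j\le\lfloor n/2\rfloor$;</li> <li>if $|\Pi_1|=n-1$: $\{2i-1,2i\}\cap I\ne\emptyset$ for all $1\le i\le\lceil n/2\rceil$.</li> </ul>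
   Context: $S$ is a finite simple connected graph with vertex set $\{s_1,\dots,s_n\}$, $n\ge 2$, and edge set $R$, such that $s_1,\dots,s_{n-1}$ is an induced path. The neighbours of $s_n$ are $s_{j_1},\dots,s_{j_m}$ with $1\le j_1<\dots<j_m\le n-1$. Vectors in $F_2^n$ have coordinates indexed by the vertices; $\widetilde{s}$ is the characteristic vector of vertex $s$. The flipping move of vertex $s$ is $\mathbf{s}\in\mathrm{Mat}_n(F_2)$ with $\mathbf{s}_{ab}=1$ if $a=b$, or if $b=s$ and $ab\in R$, and $0$ otherwise. $\mathbf{W}=\langle\mathbf{s_1},\dots,\mathbf{s_n}\rangle\le \mathrm{GL}_n(F_2)$ is the flipping group, acting on $F_2^n$ by left multiplication. $\mathcal{P}$ is its set of orbits (equal to the equivalence classes of the lit-only flipping puzzle); $\{0\}$ is the trivial orbit. Set $\overline{1}=\widetilde{s}_1$ and $\overline{i+1}=\mathbf{s_i}\cdots\mathbf{s_1}\overline{1}$ for $1\le i\le n-1$. $\Pi=\{\overline1,\dots,\overline n\}$, $\Pi_0=\{\overline i\in\Pi:\langle\overline i,\widetilde s_n\rangle=0\}$ (dot product over $F_2$), $\Pi_1=\Pi\setminus\Pi_0$, and $[\overline i]=\{\overline1,\dots,\overline i\}$ with $[\overline0]=\emptyset$. $U=\mathrm{span}(\Pi)$, which equals $F_2^n$ when $|\Pi_1|$ is odd. In that case $\Delta=\Pi$ is a basis of $F_2^n$. $\Delta(u)$ is the subset of $\Delta$ summing to $u$, $sw(u)=|\Delta(u)|$, and $V_T=\{u\in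 V: sw(u)\in T\}$ for $V\subseteq F_2^n$, $T\subseteq\{0,\dots,n\}$. $w(u)$ is the Hamming weight, $w(O)=\min_{u\in O}w(u)$, and $M(S)=\max_{O\in\mathcal P}w(O)$. $I=\{i\in[n]: |[\overline{i}]\cap\Pi_1| \text{ even, or } i=n, \text{ or } |[\overline{n-i}]\cap\Pi_1| \text{ odd}\}$, where $[n]=\{1,\dots,n\}$. *)

(* Defs.v *)
From HB Require Import structures.
From mathcomp Require Import all_boot all_algebra all_fingroup.

Set Implicit Arguments.
Unset Strict Implicit.
Unset Printing Implicit Defensive.

Import GRing.Theory.
Local Open Scope ring_scope.

(* A graph on n = k.+2 >= 2 vertices is a relation e on 'I_n; the vertex s_i  *)
(* (1 <= i <= n) is the ordinal of value i - 1. The successor form of n makes *)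
(* square matrices over 'F_2 a ring, so that {'GL_n['F_2]} applies.           *)

Section FlippingPuzzle.

Variable k : nat.
Local Notation n := k.+2.
Variable e : rel 'I_n.

Definition vtx (i : nat) : 'I_n := inord i.-1.

Definition connected_graph : Prop := forall x y : 'I_n, connect e x y.

Definition induced_path : Prop :=
  forall i j, (1 <= i <= n.-1)%N -> (1 <= j <= n.-1)%N ->
    e (vtx i) (vtx j) = (i.+1 == j) || (j.+1 == i).

Definition chi (s : 'I_n) : 'cV['F_2]_n := \col_a (a == s)%:R.

Definition dot (u v : 'cV['F_2]_n) : 'F_2 := \sum_a u a 0 * v a 0.

Definition flip (s : 'I_n) : 'M['F_2]_n :=
  \matrix_(a, b) ((a == b) || (b == s) && e a b)%:R.

Lemma flip_involutive s : flip s *m flip s = 1%:M.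
Proof.
have flipE a b :
    flip s a b = (a == b)%:R + [&& a != s, b == s & e a b]%:R.
  rewrite mxE; case: (eqVneq a b) => [<-|ab] /=.
    by case: (a == s); rewrite /= addr0.
  rewrite add0r; case: (eqVneq b s) ab => [->|_] /=; last by rewrite andbF.
  by move=> ->.
apply/matrixP => a b; rewrite mxE [RHS]mxE.
under eq_bigr => c _ do rewrite (flipE a c) mulrDl.
rewrite big_split /= (bigD1 a) //= eqxx mul1r big1 => [|c ca]; last first.
  by rewrite eq_sym (negbTE ca) mul0r.
rewrite (bigD1 s) //= [X in _ + (_ + X)]big1 => [|c cs]; last first.
  by rewrite (negbTE cs) andbF mul0r.
rewrite !addr0 !flipE !eqxx /= addr0 -addrA [s == b]eq_sym.
case: (eqVneq b s) => [->|_]; last by rewrite mulr0 andbF !addr0.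
rewrite mulr1.
by rewrite andTb (addrr_pchar2 (pchar_Fp (isT : prime 2))) addr0.
Qed.

Lemma flip_unit s : flip s \is a GRing.unit.
Proof.
by apply/unitrP; exists (flip s); split; exact: flip_involutive.
Qed.

Definition flipGL (s : 'I_n) : {'GL_n['F_2]} :=
  FinRing.unit 'M['F_2]_n (flip_unit s).

Definition W : {group {'GL_n['F_2]}} := <<[set flipGL s | s : 'I_n]>>%G.

Definition orb (u : 'cV['F_2]_n) : {set 'cV['F_2]_n} :=
  [set (GLval g : 'M['F_2]_n) *m u | g : {'GL_n['F_2]} in W].

Definition orbits : {set {set 'cV['F_2]_n}} := [set orb u | u : 'cV['F_2]_n].

Definition nontrivial_orbits : {set {set 'cV['F_2]_n}} :=
  orbits :\ [set 0 : 'cV['F_2]_n].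

(* ovl i is \overline{i} for 1 <= i <= n; the value at 0 is junk. *)
Fixpoint ovl (i : nat) : 'cV['F_2]_n :=
  match i with
  | 0 | 1 => chi (vtx 1)
  | (_.+1 as j).+1 => flip (vtx j) *m ovl j
  end.

(* seg i is [\overline{i}] = {\overline{1}, ..., \overline{i}}. *)
Definition seg (i : nat) : {set 'cV['F_2]_n} := [set ovl j.+1 | j : 'I_i].

Definition Pi : {set 'cV['F_2]_n} := seg n.
Definition Pi0 : {set 'cV['F_2]_n} := [set v in Pi | dot v (chi (vtx n)) == 0].
Definition Pi1 : {set 'cV['F_2]_n} := Pi :\: Pi0.

Definition U : {vspace 'cV['F_2]_n} := <<enum Pi>>%VS.

(* The following is meaningful when #|Pi1| is odd: Pi is then a basis of      *)
(* 'cV['F_2]_n, so Delta u is the unique subset of Pi summing to u.           *)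
Definition Delta (u : 'cV['F_2]_n) : {set 'cV['F_2]_n} :=
  odflt set0
    [pick D : {set 'cV['F_2]_n} | (D \subset Pi) && (\sum_(v in D) v == u)].

Definition sw (u : 'cV['F_2]_n) : nat := #|Delta u|.

Definition UT (T : {pred nat}) : {set 'cV['F_2]_n} :=
  [set u | (u \in U) && (sw u \in T)].

Definition wt (u : 'cV['F_2]_n) : nat := #|[set a | u a 0 != 0]|.

(* The default value n bounds every wt u, so this is the minimum over O as    *)
(* soon as O is nonempty.                                                     *)
Definition wt_orbit (O : {set 'cV['F_2]_n}) : nat :=
  \big[minn/n]_(u in O) wt u.

Definition MS : nat := \max_(O in orbits) wt_orbit O.

Definition Iset : {pred nat} :=
  [pred i | (1 <= i <= n)%N &
    [|| ~~ odd #|seg i :&: Pi1|, i == n | odd #|seg (n - i)%N :&: Pi1|]].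

Definition odds : {pred nat} := [pred i | (1 <= i <= n)%N & odd i].

End FlippingPuzzle.

(* Main.v *)
Require Import Defs.
From mathcomp Require Import all_boot all_algebra all_fingroup.
From mathcomp Require Import zify.

(* Index the basis Pi by 'I_n and identify a vector with the set A of indices *)
(* of the basis vectors summing to it. The flips at s_1, ..., s_(n-1) act on  *)
(* A as the adjacent transpositions, so the size of A is the only invariant   *)
(* of the group they generate. The neighbours of s_n sum to the sum of Pi0,   *)
(* so the flip at s_n complements A inside Pi0 when A meets Pi1 in an odd     *)
(* number of indices and fixes A otherwise: it glues the sizes a + b and      *)
(* a + (n - #|Pi1| - b), for a odd. For the weights, the sum of an initial    *)
(* segment of length i < n is chi s_i or chi s_i + chi s_n, while chi s_n is  *)
(* the sum of all of Pi; hence every size has a vector of weight at most 2,   *)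
(* and Iset is exactly the set of sizes of the vectors of weight 1.           *)

Set Implicit Arguments.
Unset Strict Implicit.
Unset Printing Implicit Defensive.

Import GRing.Theory.

(** [phi] is a bijection from index sets onto F_2^n ([phi_inj], [phi_surj]) that turns [sw] into
    cardinality ([sw_phi]). Index sets of equal size lie in one orbit ([orb_phi_init]), the flip at
    s_n gives the gluings [orb_size_jump], and [orb_inv] shows that there are no others. The orbits
    thus correspond to the classes of {0, ..., n} generated by a + b ~ a + (n - #|P1| - b), for a
    odd, a <= #|P1| and b <= n - #|P1|. For #|P1| = 1 this is s ~ n + 1 - s on positive sizes; for n
    - 2 all odd sizes merge and the even ones stay alone; for n - 1 it pairs 2i - 1 with 2i. Each
    case has [uphalf n] nontrivial classes, so [size_classification] treats them uniformly through a
    function [cls] numbering the classes. By [IsetP], a class contains a vector of weight 1 exactly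
    when it meets [Iset]; [phi_init] gives the bound 2. *)

Section F2.

Local Open Scope ring_scope.

(** * Elements of F_2 as booleans and parities *)

Lemma F2_natr (x : 'F_2) : x = (x != 0)%:R.
Proof. by case: x => [[|[|m]] lt_m] //; apply: val_inj. Qed.

Lemma F2_addbr (b c : bool) : b%:R + c%:R = (b (+) c)%:R :> 'F_2.
Proof. by case: b; case: c; apply: val_inj. Qed.

Lemma F2_boolr_inj : injective (fun b : bool => b%:R : 'F_2).
Proof. by case; case. Qed.

Lemma F2_oddr (m : nat) : m%:R = (odd m)%:R :> 'F_2.
Proof. by elim: m => //= m IH; rewrite -natr1 IH; case: (odd m); apply: val_inj. Qed.

Lemma F2_sum_bool (I : finType) (A : {set I}) (p : pred I) :
  \sum_(i in A) (p i)%:R = (odd #|[set i in A | p i]|)%:R :> 'F_2.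
Proof.
rewrite -natr_sum F2_oddr; congr (odd _)%:R.
by rewrite -sum1dep_card big_mkcondr /=; apply: eq_bigr => i _; case: (p i).
Qed.

End F2.

(** * Hamming weight *)

Section Weights.

Local Open Scope ring_scope.

Variable k : nat.
Local Notation n := k.+2.
Implicit Type u : 'cV['F_2]_n.

Lemma wt_eq0 u : (wt u == 0%N) = (u == 0).
Proof.
rewrite /wt cards_eq0; apply/eqP/eqP => [u0 | ->].
  apply/colP => a; rewrite mxE; apply/eqP; apply: contraFT (in_set0 a) => nz_a.
  by rewrite -u0 inE.
by apply/setP => a; rewrite !inE mxE eqxx.
Qed.

Lemma wt_chi (a : 'I_n) : wt (chi a) = 1%N.
Proof.
rewrite /wt -[RHS](cards1 a); apply: eq_card => b; rewrite !inE mxE.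
by case: (b == a).
Qed.

Lemma wt_eq1 u : wt u = 1%N -> exists a, u = chi a.
Proof.
move=> /eqP/cards1P[a def_a]; exists a; apply/colP => b; rewrite [u b 0]F2_natr mxE.
by have /setP/(_ b) := def_a; rewrite !inE => ->.
Qed.

Lemma wt_chi2 (a b : 'I_n) (x : 'F_2) : (wt (chi a + x *: chi b) <= 2)%N.
Proof.
apply: (@leq_trans #|[set a; b]|); last by rewrite cards2; case: eqP.
apply/subset_leq_card/subsetP => c; rewrite !inE !mxE.
by case: (c == a); case: (c == b); rewrite //= mulr0 addr0 eqxx.
Qed.

Lemma wt_orbit_le (O : {set 'cV['F_2]_n}) u : u \in O -> (wt_orbit O <= wt u)%N.
Proof.
rewrite /wt_orbit => Ou; have := mem_index_enum u.
elim: (index_enum _) => // v r IH; rewrite inE big_cons => /predU1P[<-|ru].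
  by rewrite Ou geq_minl.
by case: ifP => _; rewrite ?geq_min IH ?orbT.
Qed.

(** The bound [m <= n] rules out that the small value is the default [n] of the minimum. *)
Lemma wt_orbit_lt (O : {set 'cV['F_2]_n}) (m : nat) :
  (m <= n)%N -> (wt_orbit O < m)%N -> exists2 u, u \in O & (wt u < m)%N.
Proof.
move=> le_mn lt_m; apply/exists_inP; apply: contraLR lt_m.
rewrite negb_exists_in -leqNgt => /forall_inP ge_m.
rewrite /wt_orbit; elim/big_ind: _ => // [x y|u Ou]; first by rewrite leq_min => -> ->.
by rewrite leqNgt ge_m.
Qed.

End Weights.

(** * Coordinates of the vectors of [Pi] *)

Section Coordinates.

Local Open Scope ring_scope.

Variables (k : nat) (e : rel 'I_k.+2).
Local Notation n := k.+2.
Hypothesis e_sym : symmetric e.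
Hypothesis e_irr : irreflexive e.
Hypothesis e_path : induced_path e.

Lemma path_edge (a b : 'I_n) :
  (a < k.+1)%N -> (b < k.+1)%N -> e a b = (a.+1 == b) || (b.+1 == a).
Proof.
move=> lt_a lt_b; have := e_path (i := a.+1) (j := b.+1).
by rewrite /vtx /= !inord_val; apply; rewrite ?ltnS.
Qed.

Lemma flip_mulE (s a : 'I_n) (u : 'cV['F_2]_n) :
  (flip e s *m u) a 0 = u a 0 + (e a s)%:R * u s 0.
Proof.
rewrite mxE (bigD1 a) //= mxE eqxx mul1r; congr (_ + _).
have [->|neq_as] := eqVneq a s.
  rewrite e_irr mul0r big1 // => b neq_bs.
  by rewrite mxE eq_sym (negbTE neq_bs) mul0r.
rewrite (bigD1 s) ?[s == a]eq_sym //= mxE eqxx (negbTE neq_as) /= big1 ?addr0 //.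
move=> b /andP[neq_ba neq_bs].
by rewrite mxE eq_sym (negbTE neq_ba) (negbTE neq_bs) mul0r.
Qed.

Definition bvec (i : 'I_n) : 'cV['F_2]_n := ovl e i.+1.

Lemma ovlSS (j : nat) : ovl e j.+2 = flip e (inord j) *m ovl e j.+1.
Proof. by []. Qed.

(** Flipping the vertex of ordinal j, where the coordinate is 1, cancels the coordinate at j - 1 and
    creates one at j + 1: along the path the support {j - 1, j} slides to {j, j + 1}. *)
Lemma ovl_path (j : nat) (a : 'I_n) : (j < n)%N -> (a < k.+1)%N ->
  ovl e j.+1 a 0 = ((a == j :> nat) (+) (a.+1 == j))%:R.
Proof.
move=> lt_jn lt_a; elim: j lt_jn a lt_a => [|j IH] lt_jn a lt_a.
  by rewrite /= mxE -val_eqE /vtx /= inordK // addbF.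
have jK : (inord j : 'I_n) = j :> nat by rewrite inordK //; lia.
rewrite ovlSS flip_mulE !IH ?jK //; try lia.
rewrite path_edge ?jK // eqxx /=.
rewrite (_ : (j.+1 == j) = false) ?mulr1; last by lia.
by rewrite F2_addbr; congr (nat_of_bool _)%:R; lia.
Qed.

Lemma bvec_path (i a : 'I_n) : (a < k.+1)%N ->
  bvec i a 0 = ((a == i) (+) (a.+1 == i))%:R.
Proof. by move=> lt_a; rewrite /bvec ovl_path. Qed.

Definition P1 : {set 'I_n} := [set i | bvec i ord_max 0 != 0].

Lemma bvec_last (i : 'I_n) : bvec i ord_max 0 = (i \in P1)%:R.
Proof. by rewrite inE -F2_natr. Qed.

Lemma P1_ord0 : ord0 \notin P1.
Proof.
rewrite inE /bvec /= mxE (_ : (ord_max == _) = false) ?eqxx //.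
by rewrite -val_eqE /vtx /= inordK.
Qed.

(** [bvec i] has coordinate 1 at vertex i, so the flip there toggles the coordinate at s_n exactly
    when that vertex is a neighbour of s_n. The neighbours of s_n are thus the places where
    membership in [P1] changes. *)
Lemma P1_succ (i j : 'I_n) : j = i.+1 :> nat ->
  (j \in P1) = (i \in P1) (+) e ord_max i.
Proof.
move=> def_j; have lt_i : (i < k.+1)%N by have := ltn_ord j; lia.
apply: F2_boolr_inj; rewrite -F2_addbr -!bvec_last /bvec def_j ovlSS.
rewrite inord_val flip_mulE (@ovl_path i i) // eqxx (_ : (i.+1 == i) = false) ?mulr1 //.
lia.
Qed.

(* Without connectedness bvec need not be injective: for n = 2 the indices 0  *)
(* and 1 may collide. Index 0 is never in P1, which makes the restriction to  *)
(* P1 injective, so that #|Pi1| can be computed before Pi is a basis.         *)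
Lemma bvec_P1_inj : {in P1 &, injective bvec}.
Proof.
suff lt_neq (i j : 'I_n) : i \in P1 -> (i < j)%N -> bvec i != bvec j.
  move=> i j Pi Pj /eqP; have [lt_ij|lt_ji|/val_inj//] := ltngtP i j.
    by rewrite (negbTE (lt_neq _ _ Pi lt_ij)).
  by rewrite eq_sym (negbTE (lt_neq _ _ Pj lt_ji)).
move=> Pi lt_ij; apply/eqP => eq_ij.
have i_gt0 : (0 < i)%N.
  rewrite lt0n; apply: contraL Pi => /eqP i0.
  by rewrite (_ : i = ord0) ?P1_ord0 //; apply: val_inj.
have lt_j := ltn_ord j; have iK : (inord i.-1 : 'I_n) = i.-1 :> nat by rewrite inordK; lia.
have /colP/(_ (inord i.-1)) := eq_ij.
rewrite !bvec_path -?val_eqE /= ?iK; try lia.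
by move/F2_boolr_inj; lia.
Qed.

Lemma segE (i : nat) : (i <= n)%N -> seg e i = bvec @: [set j : 'I_n | (j < i)%N].
Proof.
move=> le_in; apply/setP => u; apply/imsetP/imsetP => -[j lt_j ->].
  by exists (widen_ord le_in j); rewrite ?inE /=.
by rewrite inE in lt_j; exists (Ordinal lt_j).
Qed.

Lemma Pi1E : Pi1 e = bvec @: P1.
Proof.
have dotE u : dot u (chi (vtx k n)) = u ord_max 0.
  have -> : vtx k n = ord_max by apply: val_inj; rewrite /vtx /= inordK.
  rewrite /dot (bigD1 ord_max) //= mxE eqxx mulr1 big1 ?addr0 // => a neq_a.
  by rewrite mxE (negbTE neq_a) mulr0.
apply/setP => u; rewrite !inE dotE /Pi segE //; apply/andP/imsetP.
  case=> u_last /imsetP[i _ def_u]; exists i => //; rewrite inE -def_u.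
  by apply: contra u_last => /eqP ->; rewrite def_u eqxx andbT imset_f ?inE.
case=> i Pi ->; have i_seg : bvec i \in bvec @: [set j : 'I_n | (j < n)%N].
  by rewrite imset_f ?inE.
by split=> //; rewrite i_seg; move: Pi; rewrite inE.
Qed.

Lemma card_Pi1 : #|Pi1 e| = #|P1|.
Proof. by rewrite Pi1E card_in_imset //; apply: bvec_P1_inj. Qed.

(** * Vectors as index sets, and the flips acting on them *)

Definition phi (A : {set 'I_n}) : 'cV['F_2]_n := \sum_(i in A) bvec i.

Definition symdiff (A B : {set 'I_n}) : {set 'I_n} :=
  [set i | (i \in A) (+) (i \in B)].

(** Only [bvec a] and [bvec b] have vertex a in their support. With [phi_last], [phi A] records the
    boundary of [A] along the path and one parity bit. *)
Lemma phi_path (A : {set 'I_n}) (a b : 'I_n) : b = a.+1 :> nat ->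
  phi A a 0 = ((a \in A) (+) (b \in A))%:R.
Proof.
move=> def_b; have lt_a : (a < k.+1)%N by have := ltn_ord b; lia.
rewrite -F2_addbr summxE.
under eq_bigr => i _ do rewrite bvec_path // -F2_addbr -def_b !val_eqE.
have sum_eq (x : 'I_n) : \sum_(i in A) (x == i)%:R = (x \in A)%:R :> 'F_2.
  rewrite big_mkcond (bigD1 x) //= eqxx big1 ?addr0; first by case: ifP.
  by move=> i neq_i; rewrite eq_sym (negbTE neq_i) if_same.
by rewrite big_split !sum_eq.
Qed.

Lemma phi_last (A : {set 'I_n}) : phi A ord_max 0 = (odd #|A :&: P1|)%:R.
Proof.
rewrite summxE; under eq_bigr => i _ do rewrite bvec_last.
by rewrite F2_sum_bool; congr (odd #|pred_of_set _|)%:R; apply/setP => i; rewrite !inE.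
Qed.

Lemma ord_max_or_lt (a : 'I_n) : a = ord_max \/ exists b : 'I_n, b = a.+1 :> nat.
Proof.
have [lt_a|ge_a] := ltnP a k.+1; last by left; apply: val_inj => /=; have := ltn_ord a; lia.
by right; exists (inord a.+1); rewrite inordK.
Qed.

Lemma odd_symdiffI (A B C : {set 'I_n}) :
  odd #|symdiff A B :&: C| = odd #|A :&: C| (+) odd #|B :&: C|.
Proof.
apply: F2_boolr_inj; rewrite -F2_addbr.
have oddI D : (odd #|D :&: C|)%:R = \sum_i ((i \in D) && (i \in C))%:R :> 'F_2.
  rewrite -natr_sum [RHS]F2_oddr -sum1_card big_mkcond; congr (nat_of_bool (odd _))%:R.
  by apply: eq_bigr => i _; rewrite inE; case: ifP.
rewrite !oddI -big_split; apply: eq_bigr => i _ /=; rewrite F2_addbr inE.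
by case: (i \in C); rewrite ?andbT ?andbF.
Qed.

Lemma phi_symdiff (A B : {set 'I_n}) : phi (symdiff A B) = phi A + phi B.
Proof.
apply/colP => a; rewrite mxE; have [->|[b def_b]] := ord_max_or_lt a.
  by rewrite !phi_last F2_addbr odd_symdiffI.
by rewrite !(phi_path _ def_b) F2_addbr !inE addbACA.
Qed.

(** The flip sends [bvec i] to [bvec j] by construction and, being an involution, back again; all
    other basis vectors vanish at vertex i and are fixed. *)
Lemma flip_path_phi (i j : 'I_n) (A : {set 'I_n}) : j = i.+1 :> nat ->
  flip e i *m phi A = phi (tperm i j @: A).
Proof.
move=> def_j; have lt_j := ltn_ord j.
have flip_i : flip e i *m bvec i = bvec j by rewrite /bvec def_j ovlSS inord_val.
have flip_b l : flip e i *m bvec l = bvec (tperm i j l).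
  case: tpermP => [->//|->|/eqP neq_i /eqP neq_j].
    by rewrite -flip_i mulmxA flip_involutive mul1mx.
  apply/colP => a; rewrite flip_mulE [bvec l i 0]bvec_path; last by lia.
  rewrite -def_j !val_eqE eq_sym (negbTE neq_i) eq_sym (negbTE neq_j).
  by rewrite mulr0 addr0.
rewrite /phi mulmx_sumr big_imset /=; last by move=> ? ? _ _; apply: perm_inj.
by apply: eq_bigr => l _; rewrite flip_b.
Qed.

Hypothesis P1_odd : odd #|P1|.

(** The flip adds the neighbourhood vector of s_n when the coordinate at s_n is 1. By [P1_succ] that
    vector has the same path coordinates as [phi (~: P1)], and both vanish at s_n. *)
Lemma flip_last_phi (A : {set 'I_n}) :
  flip e ord_max *m phi A =
  phi (if odd #|A :&: P1| then symdiff A (~: P1) else A).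
Proof.
have def_nb : \col_a (e a ord_max)%:R = phi (~: P1) :> 'cV['F_2]_n.
  apply/colP => a; rewrite mxE; have [->|[b def_b]] := ord_max_or_lt a.
    by rewrite e_irr phi_last setIC setICr cards0.
  rewrite (phi_path _ def_b) ![_ \in ~: _]in_setC (P1_succ def_b) e_sym.
  by case: (_ \in _); case: (e _ _).
transitivity (phi A + phi A ord_max 0 *: phi (~: P1)).
  by rewrite -def_nb; apply/colP => a; rewrite flip_mulE !mxE mulrC.
rewrite phi_last; case: ifP => _; first by rewrite phi_symdiff scale1r.
by rewrite scale0r addr0.
Qed.

(** If [phi D] is 0, the path coordinates make membership in [D] constant, so [D] is empty or full;
    the full set has coordinate 1 at s_n because #|P1| is odd. *)
Lemma phi_inj : injective phi.
Proof.
move=> A B eq_AB; pose D := symdiff A B.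
have phiD : phi D = 0.
  by rewrite phi_symdiff eq_AB; apply/colP => a; rewrite !mxE [phi B a 0]F2_natr F2_addbr addbb.
have D_const (i : 'I_n) : (i \in D) = (ord0 \in D).
  case: i => i; elim: i => [|i IH] lt_i; first by congr (_ \in D); apply: val_inj.
  have lt_i' : (i < n)%N by apply: ltnW.
  rewrite -(IH lt_i'); have := @phi_path D (Ordinal lt_i') (Ordinal lt_i) erefl.
  by rewrite phiD mxE => /(F2_boolr_inj (x1 := false)); do 2!case: (_ \in D).
have D0 : (ord0 \in D) = false.
  apply/negP => D0; have := phi_last D; rewrite phiD mxE.
  have -> : D = setT by apply/setP => i; rewrite D_const D0 inE.
  by rewrite setTI P1_odd => /(F2_boolr_inj (x1 := false)).
apply/setP => i; move: (D_const i); rewrite D0 inE.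
by do 2!case: (i \in _).
Qed.

Lemma phi_surj (u : 'cV['F_2]_n) : exists A, phi A = u.
Proof.
have card_le : (#|{: 'cV['F_2]_n}| <= #|{: {set 'I_n}}|)%N.
  by rewrite card_mx card_Fp // muln1 -cardsT -powersetT card_powerset cardsT card_ord.
have [g _ gK] := inj_card_bij phi_inj card_le.
by exists (g u); rewrite gK.
Qed.

Lemma bvec_inj : injective bvec.
Proof. by move=> i j eq_ij; apply/set1_inj/phi_inj; rewrite /phi !big_set1. Qed.

Lemma PiE : Pi e = bvec @: setT.
Proof.
rewrite /Pi segE // (_ : [set j : 'I_n | (j < n)%N] = setT) //.
by apply/setP => i; rewrite !inE ltn_ord.
Qed.

Lemma mem_U (u : 'cV['F_2]_n) : u \in U e.
Proof.
have [A <-] := phi_surj u; apply: memv_suml => i _; apply: memv_span.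
by rewrite mem_enum PiE imset_f.
Qed.

(** By injectivity of [phi], the only candidate for [Delta] is [bvec @: A]; as it qualifies, the
    default value never occurs. *)
Lemma sw_phi (A : {set 'I_n}) : sw e (phi A) = #|A|.
Proof.
have sum_im (B : {set 'I_n}) : \sum_(v in bvec @: B) v = phi B.
  by rewrite big_imset //= => ? ? _ _; apply: bvec_inj.
rewrite /sw /Delta; case: pickP => [D /andP[sDP /eqP sumD] | /(_ (bvec @: A))].
  have defD : D = bvec @: (bvec @^-1: D).
    apply/setP => v; apply/idP/imsetP => [Dv | [i]]; last by rewrite inE => ? ->.
    have := subsetP sDP v Dv; rewrite PiE => /imsetP[i _ def_v].
    by exists i; rewrite ?inE -?def_v.
  move: sumD; rewrite {1}defD sum_im => /phi_inj <-.
  by rewrite /= {1}defD card_imset //; apply: bvec_inj.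
by rewrite sum_im eqxx PiE imsetS ?subsetT.
Qed.

Lemma sw_le (u : 'cV['F_2]_n) : (sw e u <= n)%N.
Proof. by have [A <-] := phi_surj u; rewrite sw_phi -[n in X in (_ <= X)%N]card_ord max_card. Qed.

Lemma phi0 : phi set0 = 0.
Proof. by rewrite /phi big_set0. Qed.

Lemma sw_eq0 (u : 'cV['F_2]_n) : (sw e u == 0%N) = (u == 0).
Proof.
have [A <-] := phi_surj u.
by rewrite sw_phi cards_eq0 -phi0 (inj_eq phi_inj).
Qed.

(** * Orbits and sizes *)

Lemma orb_W (g : {'GL_n['F_2]}) (u : 'cV['F_2]_n) :
  g \in W e -> orb e (GLval g *m u) = orb e u.
Proof.
move=> Wg; apply/setP => v; apply/imsetP/imsetP => -[h Wh ->].
  by exists (h * g)%g; rewrite ?groupM // GL_ME mulmxA.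
exists (h * g^-1)%g; first by rewrite groupM ?groupV.
by rewrite mulmxA -{1}[h](mulgKV g) GL_ME.
Qed.

Lemma orb_flip (s : 'I_n) (u : 'cV['F_2]_n) : orb e (flip e s *m u) = orb e u.
Proof. by rewrite -(@orb_W (flipGL e s) u) // mem_gen ?imset_f. Qed.

Lemma mem_orb (u : 'cV['F_2]_n) : u \in orb e u.
Proof. by apply/imsetP; exists 1%g; rewrite ?group1 // GL_1E mul1mx. Qed.

(** The matrices preserving [f] form a group; containing the generators, it contains [W]. *)
Lemma orb_inv (T : eqType) (f : 'cV['F_2]_n -> T) :
    (forall s u, f (flip e s *m u) = f u) ->
  forall u v, v \in orb e u -> f v = f u.
Proof.
move=> f_flip u v /imsetP[g Wg ->].
pose G : {set {'GL_n['F_2]}} := 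
  [set h : {'GL_n['F_2]} | [forall x : 'cV['F_2]_n, f ((GLval h : 'M['F_2]_n) *m x) == f x]].
have gG : group_set G.
  apply/group_setP; split=> [|h1 h2].
    by rewrite inE; apply/forallP => x; rewrite GL_1E mul1mx.
  rewrite !inE => /forallP fh1 /forallP fh2; apply/forallP => x.
  by rewrite GL_ME -mulmxA (eqP (fh1 _)) (eqP (fh2 _)).
have: W e \subset Group gG.
  rewrite gen_subG; apply/subsetP => _ /imsetP[s _ ->].
  by rewrite inE; apply/forallP => x; rewrite f_flip.
by move/subsetP/(_ g Wg); rewrite inE => /forallP/(_ u)/eqP.
Qed.

Definition init (m : nat) : {set 'I_n} := [set j : 'I_n | (j < m)%N].

Lemma card_init (m : nat) : (m <= n)%N -> #|init m| = m.
Proof.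
move=> le_mn; rewrite -sum1dep_card -(big_ord_widen _ (fun=> 1%N)) //.
by rewrite sum1_card card_ord.
Qed.

Lemma orb_phi_init (A : {set 'I_n}) : orb e (phi A) = orb e (phi (init #|A|)).
Proof.
(* Induction on the sum of the indices: swapping a missing i with a present i + 1 lowers it by
   one. *)
have [m] := ubnP (\sum_(i in A) val i)%N; elim: m A => // m IH A; rewrite ltnS => le_m.
have [[i j] /= /and3P[/eqP def_j Ai Aj]|down] :=
    pickP [pred p : 'I_n * 'I_n | [&& val p.2 == p.1.+1, p.1 \notin A & p.2 \in A]].
  rewrite -(orb_flip i) (flip_path_phi _ def_j) IH ?card_imset //; try exact: perm_inj.
  apply: leq_trans le_m; rewrite big_imset /=; last by move=> ? ? _ _; apply: perm_inj.
  rewrite (bigD1 j) //= [X in (_ < X)%N](bigD1 j) //= tpermR def_j.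
  rewrite (eq_bigr val) ?ltnS ?leq_add2r //.
  move=> l /andP[Al neq_lj]; rewrite tpermD // 1?eq_sym //.
  by apply: contraNneq Ai => <-.
(* With no such pair left, [A] is closed under predecessors: each i in [A] brings all of
   [init i.+1], whence i < #|A|. *)
congr (orb e (phi _)); apply/eqP; rewrite eqEcard card_init; last first.
  by rewrite -[n in X in (_ <= X)%N]card_ord max_card.
rewrite leqnn andbT; apply/subsetP => i Ai; rewrite inE -(@card_init i.+1) //.
apply/subset_leq_card/subsetP => j; rewrite inE ltnS.
have [d] := ubnP (i - j)%N; elim: d j => // d IHd j le_d le_ji.
have [->//|neq_ji] := eqVneq j i.
have lt_ji : (j < i)%N by rewrite ltn_neqAle neq_ji.
have lt_i := ltn_ord i; have jK : (inord j.+1 : 'I_n) = j.+1 :> nat by rewrite inordK; lia.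
have Aj1 : inord j.+1 \in A by apply: IHd; rewrite jK; lia.
by have := down (j, inord j.+1); rewrite /= jK eqxx Aj1 andbT /= => /negbFE.
Qed.

Lemma card_setIC (A B : {set 'I_n}) : #|A| = (#|A :&: B| + #|A :&: ~: B|)%N.
Proof. by rewrite -setDE cardsID. Qed.

Lemma card_symdiffC (A B : {set 'I_n}) :
  #|symdiff A (~: B)| = (#|A :&: B| + (n - #|B| - #|A :&: ~: B|))%N.
Proof.
rewrite (card_setIC _ B); congr (_ + _)%N.
  by apply: eq_card => i; rewrite !inE; case: (i \in B); rewrite ?andbF //= addbF.
have -> : symdiff A (~: B) :&: ~: B = ~: B :\: A.
  by apply/setP => i; rewrite !inE; case: (i \in A); case: (i \in B).
by rewrite cardsD setIC; congr (_ - _)%N; rewrite [LHS]cardsCs setCK card_ord.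
Qed.

(** Apply the flip at s_n to a set with a indices inside [P1] and b outside: a odd makes the flip
    act, and it complements the outer part. *)
Lemma orb_size_jump (a b s t : nat) :
    odd a -> (a <= #|P1|)%N -> (b <= n - #|P1|)%N ->
    s = (a + b)%N -> t = (a + (n - #|P1| - b))%N ->
  orb e (phi (init s)) = orb e (phi (init t)).
Proof.
move=> odd_a le_a le_b -> ->.
have sub_card (B : {set 'I_n}) m : (m <= #|B|)%N -> exists2 C : {set 'I_n}, C \subset B & #|C| = m.
  move=> le_m; exists [set x in take m (enum B)].
    by apply/subsetP => x; rewrite inE => /mem_take; rewrite mem_enum.
  by rewrite cardsE (card_uniqP _) ?take_uniq ?enum_uniq // size_takel // -cardE.
have [C sCP cardC] := sub_card _ _ le_a.
have [|D sDP cardD] := sub_card (~: P1) b; first by rewrite cardsCs setCK card_ord.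
have CDP : (C :|: D) :&: P1 = C.
  apply/setP => x; have /implyP := subsetP sCP x; have /implyP := subsetP sDP x.
  by rewrite !in_setI ?in_setC in_setU; case: (x \in C); case: (x \in D); case: (x \in P1).
have CDC : (C :|: D) :&: ~: P1 = D.
  apply/setP => x; have /implyP := subsetP sCP x; have /implyP := subsetP sDP x.
  by rewrite !in_setI ?in_setC in_setU; case: (x \in C); case: (x \in D); case: (x \in P1).
have <- : #|C :|: D| = (a + b)%N by rewrite (card_setIC _ P1) CDP CDC cardC cardD.
rewrite -orb_phi_init -(orb_flip ord_max) flip_last_phi CDP cardC odd_a.
by rewrite orb_phi_init card_symdiffC CDP CDC cardC cardD.
Qed.

(** * Vectors of weight at most 2 and their sizes *)

Lemma chi_coord (a b : 'I_n) : chi a b 0 = (b == a)%:R.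
Proof. by rewrite mxE. Qed.

Lemma phi_setT : phi setT = chi ord_max.
Proof.
apply/colP => a; rewrite chi_coord; have [->|[b def_b]] := ord_max_or_lt a.
  by rewrite phi_last setTI P1_odd eqxx.
rewrite (phi_path _ def_b) !inE (_ : (a == ord_max) = false) //.
by rewrite -val_eqE /=; have := ltn_ord b; lia.
Qed.

Lemma phi_setC (A : {set 'I_n}) : phi (~: A) = phi A + chi ord_max.
Proof.
rewrite -phi_setT -phi_symdiff; congr phi.
by apply/setP => i; rewrite !inE; case: (i \in A).
Qed.

(** An initial segment has a single boundary point on the path, its last index. *)
Lemma phi_init (a : 'I_n) : (a < k.+1)%N ->
  phi (init a.+1) = chi a + (odd #|init a.+1 :&: P1|)%:R *: chi ord_max.
Proof.
move=> lt_a; apply/colP => c; rewrite !mxE; have [->|[b def_b]] := ord_max_or_lt c.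
  rewrite phi_last eqxx mulr1 (_ : (ord_max == a) = false) ?add0r //.
  by rewrite -val_eqE /=; lia.
rewrite (phi_path _ def_b) !inE; have lt_b := ltn_ord b.
rewrite (_ : (c == ord_max) = false); last by rewrite -val_eqE /=; lia.
by rewrite mulr0 addr0 -(val_eqE c a) /=; congr (nat_of_bool _)%:R; lia.
Qed.

Lemma sw_chi_last : sw e (chi ord_max) = n.
Proof. by rewrite -phi_setT sw_phi cardsT card_ord. Qed.

(** In the odd case, the extra [chi ord_max] of [phi_init] is removed by passing to the complement,
    by [phi_setC]. *)
Lemma sw_chi (a : 'I_n) : (a < k.+1)%N ->
  sw e (chi a) = if odd #|init a.+1 :&: P1| then (n - a.+1)%N else a.+1.
Proof.
move=> lt_a; have := phi_init lt_a; case: ifP => _ def_chi.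
  have <- : phi (~: init a.+1) = chi a.
    rewrite phi_setC def_chi scale1r; apply/colP => c.
    by rewrite !mxE -addrA F2_addbr addbb addr0.
  by rewrite sw_phi cardsCs setCK card_init // card_ord.
have <- : phi (init a.+1) = chi a by rewrite def_chi scale0r addr0.
by rewrite sw_phi card_init.
Qed.

Lemma odd_seg_Pi1 (i : nat) : (i <= n)%N ->
  odd #|seg e i :&: Pi1 e| = odd #|init i :&: P1|.
Proof.
move=> le_in; rewrite segE // Pi1E -imsetI; last by move=> ? ? _ _; apply: bvec_inj.
by rewrite card_imset //; apply: bvec_inj.
Qed.

(** The three conditions in [Iset] match, in order, s_l in the even case of [sw_chi], then s_n, then
    s_(n - l) in the odd case. The predecessors below convert to ordinals counted from 0. *)
Lemma IsetP (l : nat) : reflect (exists a, sw e (chi a) = l) (l \in Iset e).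
Proof.
apply: (iffP idP) => [|[a <-]].
  rewrite inE => /andP[/andP[l_gt0 le_ln]]; have [->|neq_ln] := eqVneq l n.
    by exists ord_max; apply: sw_chi_last.
  rewrite !odd_seg_Pi1 ?leq_subr //= => /orP[even_l | odd_l].
    have lK : (inord l.-1 : 'I_n) = l.-1 :> nat by rewrite inordK; lia.
    exists (inord l.-1); rewrite sw_chi lK; last by lia.
    by rewrite prednK // (negbTE even_l).
  have lK : (inord (n - l).-1 : 'I_n) = (n - l).-1 :> nat by rewrite inordK; lia.
  exists (inord (n - l).-1); rewrite sw_chi lK; last by lia.
  by rewrite prednK ?odd_l; lia.
rewrite inE; have [->|[b def_b]] := ord_max_or_lt a.
  by rewrite sw_chi_last eqxx orbT leqnn.
have lt_b := ltn_ord b; rewrite sw_chi; last by lia.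
case: ifP => odd_a; rewrite !odd_seg_Pi1; try lia.
by rewrite subKn ?odd_a ?orbT ?andbT; lia.
Qed.

Lemma MS_le2 : (MS e <= 2)%N.
Proof.
apply/bigmax_leqP => _ /imsetP[u _ ->]; have [A <-] := phi_surj u.
rewrite orb_phi_init; apply: leq_trans (wt_orbit_le (mem_orb _)) _.
have : (#|A| <= n)%N by rewrite -[n in X in (_ <= X)%N]card_ord max_card.
case: #|A| => [|m] le_mn.
  rewrite (_ : init 0 = set0) ?phi0; last by apply/setP => i; rewrite !inE.
  by have /eqP-> : wt (0 : 'cV['F_2]_n) == 0%N by rewrite wt_eq0.
have [lt_m|ge_m] := ltnP m k.+1.
  by rewrite (@phi_init (Ordinal le_mn)) // wt_chi2.
rewrite (_ : init _ = setT) ?phi_setT ?wt_chi //.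
by apply/setP => i; rewrite !inE; have := ltn_ord i; lia.
Qed.

(** * From a numbering of the size classes to the orbits *)

Section SizeClasses.

Variable cls : nat -> nat.
(* cls numbers the orbits through the sizes, with 0 for the trivial orbit.   *)
Hypothesis cls_eq0 : forall s, (s <= n)%N -> (cls s == 0%N) = (s == 0%N).
Hypothesis cls_le : forall s, (s <= n)%N -> (cls s <= uphalf n)%N.
Hypothesis cls_onto : forall i, (i <= uphalf n)%N -> exists2 s, (s <= n)%N & cls s = i.
(** Invariance under the flip at s_n, so that an orbit never leaves its class; [cls_orb] is the
    converse, that a class is a single orbit. *)
Hypothesis cls_jump : forall a b, odd a -> (a <= #|P1|)%N -> (b <= n - #|P1|)%N ->
  cls (a + (n - #|P1| - b)) = cls (a + b).
Hypothesis cls_orb : forall s t, (s <= n)%N -> (t <= n)%N -> cls s = cls t ->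
  orb e (phi (init s)) = orb e (phi (init t)).

Definition clset (i : nat) : {set 'cV['F_2]_n} := [set u | cls (sw e u) == i].

Lemma cls_flip (s : 'I_n) (u : 'cV['F_2]_n) :
  cls (sw e (flip e s *m u)) = cls (sw e u).
Proof.
have [A <-] := phi_surj u; have [->|[b def_b]] := ord_max_or_lt s.
  rewrite flip_last_phi !sw_phi; case: ifP => // odd_A.
  rewrite card_symdiffC cls_jump ?subset_leq_card ?subsetIl ?subsetIr //.
    by rewrite -card_setIC.
  have -> : (n - #|P1|)%N = #|~: P1| by rewrite [RHS]cardsCs setCK card_ord.
  by rewrite subset_leq_card ?subsetIr.
by rewrite (flip_path_phi _ def_b) !sw_phi card_imset //; apply: perm_inj.
Qed.

Lemma orb_clset (u : 'cV['F_2]_n) : orb e u = clset (cls (sw e u)).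
Proof.
apply/setP => v; rewrite inE; apply/idP/eqP => [|eq_cls].
  by apply: (orb_inv (f := fun x => cls (sw e x))); apply: cls_flip.
suff -> : orb e u = orb e v by apply: mem_orb.
move: eq_cls; have [A <-] := phi_surj u; have [B <-] := phi_surj v.
rewrite !sw_phi (orb_phi_init A) (orb_phi_init B) => eq_cls.
by apply: cls_orb; rewrite // -?(sw_phi A) -?(sw_phi B) sw_le.
Qed.

Lemma clset_nonempty (i : nat) : (i <= uphalf n)%N -> exists u, u \in clset i.
Proof.
case/cls_onto => s le_sn <-.
by exists (phi (init s)); rewrite inE sw_phi card_init.
Qed.

Lemma orbitsE : orbits e = [set clset i | i : 'I_(uphalf n).+1].
Proof.
apply/setP => O; apply/imsetP/imsetP => [[u _ ->]|[i _ ->]].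
  have lt_u : (cls (sw e u) < (uphalf n).+1)%N by rewrite ltnS cls_le ?sw_le.
  by exists (Ordinal lt_u); rewrite // orb_clset.
have [|u] := @clset_nonempty i; first by rewrite -ltnS.
by rewrite inE => /eqP <-; exists u; rewrite // orb_clset.
Qed.

Lemma card_orbits : #|orbits e| = (uphalf n).+1.
Proof.
rewrite orbitsE card_imset ?card_ord // => i j eq_ij.
have [|u u_i] := @clset_nonempty i; first by rewrite -ltnS.
have:= u_i; rewrite eq_ij; move: u_i; rewrite !inE => /eqP cls_i /eqP cls_j.
by apply: val_inj; rewrite /= -cls_i -cls_j.
Qed.

Lemma clset0 : clset 0 = [set 0].
Proof. by apply/setP => u; rewrite !inE cls_eq0 ?sw_le ?sw_eq0. Qed.

Lemma mem_orbits_clset (i : nat) : (i <= uphalf n)%N -> clset i \in orbits e.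
Proof.
move=> le_i; rewrite orbitsE; apply/imsetP.
by exists (Ordinal (le_i : (i < _.+1)%N)).
Qed.

Lemma nontrivial_orbitsE (O : {set 'cV['F_2]_n}) :
  O \in nontrivial_orbits e <-> exists2 i, (1 <= i <= uphalf n)%N & O = clset i.
Proof.
split=> [|[i /andP[i_gt0 le_i] ->]].
  rewrite !inE orbitsE => /andP[O_neq0 /imsetP[i _ def_O]].
  exists (val i) => //; rewrite -(ltnS i) ltn_ord andbT lt0n.
  by apply: contra O_neq0 => /eqP i0; rewrite def_O i0 clset0.
rewrite inE mem_orbits_clset // andbT inE; apply/eqP => def_i.
have : 0 \in clset i by rewrite def_i inE.
rewrite inE (eqP (_ : sw e 0 == 0%N)) ?sw_eq0 // => /eqP cls0.
by have := cls_eq0 (leq0n n); rewrite cls0; lia.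
Qed.

Lemma UT_clset (T : {pred nat}) (i : nat) :
  (forall s, (s <= n)%N -> (s \in T) = (cls s == i)) -> UT e T = clset i.
Proof. by move=> eq_T; apply/setP => u; rewrite !inE mem_U eq_T ?sw_le. Qed.

(** A nontrivial orbit has minimum weight 1 exactly when it contains some [chi a], and the sizes of
    these are the elements of [Iset]. *)
Lemma MS_eq1 : MS e = 1%N <->
  forall i, (1 <= i <= uphalf n)%N -> exists2 l, cls l = i & l \in Iset e.
Proof.
have cls_gt0 u : (0 < cls (sw e u))%N -> u != 0.
  by rewrite lt0n cls_eq0 ?sw_le // sw_eq0.
split=> [MS1 i /andP[i_gt0 le_i] | clsI].
  have : (wt_orbit (clset i) < 2)%N.
    by rewrite ltnS -MS1; apply: leq_bigmax_cond; apply: mem_orbits_clset.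
  case/(wt_orbit_lt (isT : (2 <= n)%N)) => u; rewrite inE => /eqP cls_u wt_u.
  have [|a def_u] := @wt_eq1 _ u.
    have : wt u != 0%N by rewrite wt_eq0 cls_gt0 // cls_u.
    by lia.
  by exists (sw e u) => //; apply/IsetP; exists a; rewrite def_u.
apply/eqP; rewrite eqn_leq; apply/andP; split.
  apply/bigmax_leqP => O; rewrite orbitsE => /imsetP[[[|i] lt_i] _ ->] /=.
    apply: leq_trans (wt_orbit_le (u := 0) _) _; first by rewrite clset0 inE.
    by rewrite (eqP (_ : wt 0 == 0%N)) // wt_eq0.
  have [|l cls_l /IsetP[a sw_a]] := clsI i.+1; first by [].
  by rewrite -(wt_chi a) wt_orbit_le // inE sw_a cls_l.
(* Class 1 is an orbit without the zero vector, which bounds [MS] below by 1. *)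
apply: leq_trans (leq_bigmax_cond _ (@mem_orbits_clset 1 isT)).
rewrite leqNgt; apply/negP => /(wt_orbit_lt (isT : (1 <= n)%N))[u]; rewrite inE => /eqP cls_u.
by rewrite ltnS leqn0 wt_eq0; apply/negP; rewrite cls_gt0 ?cls_u.
Qed.

(** Agreement of [T] with [cls] up to n suffices, since neither [sw] nor the elements of [Iset]
    exceed n. *)
Lemma size_classification (T : nat -> {pred nat}) :
    (forall i s, (1 <= i <= uphalf n)%N -> (s <= n)%N -> (s \in T i) = (cls s == i)) ->
  [/\ forall O : {set 'cV['F_2]_n}, O \in nontrivial_orbits e <->
         exists2 i, (1 <= i <= uphalf n)%N & O = UT e (T i),
      #|orbits e| = (uphalf n).+1
    & MS e = 1%N <-> forall i, (1 <= i <= uphalf n)%N ->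
                       exists2 l, l \in T i & l \in Iset e].
Proof.
move=> T_cls; split=> [O||]; [|exact: card_orbits|].
  rewrite nontrivial_orbitsE; split=> -[i i_rng ->]; exists i => //;
    by [rewrite (@UT_clset _ i) // => s; apply: T_cls].
rewrite MS_eq1; split=> clsI i i_rng; have [l l_i lI] := clsI i i_rng; exists l => //.
  by rewrite T_cls ?l_i //; move: lI; rewrite inE => /andP[/andP[]].
by apply/eqP; rewrite -T_cls //; move: lI; rewrite inE => /andP[/andP[]].
Qed.

End SizeClasses.

(** * The three cases *)

Lemma classification_card1 : #|P1| = 1%N ->
  [/\ forall O : {set 'cV['F_2]_n}, O \in nontrivial_orbits e <->
         exists2 i, (1 <= i <= uphalf n)%N & O = UT e (pred2 i (n + 1 - i)%N),
      #|orbits e| = (uphalf n).+1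
    & MS e = 1%N <-> forall i, (1 <= i <= uphalf n)%N ->
                       exists2 l, l \in pred2 i (n + 1 - i)%N & l \in Iset e].
Proof.
(* Here a = 1 is forced, and the jump takes s = 1 + b to n - b = n + 1 - s; a class is numbered by
   its smaller size. *)
move=> p1; apply: (@size_classification (fun s => minn s (n + 1 - s))) => [s|s|i|a b|s t|i s].
- lia.
- lia.
- by move=> le_i; exists i; lia.
- by rewrite p1; lia.
- move=> le_s le_t eq_st; have [->//|neq_st] := eqVneq s t.
  by apply: (@orb_size_jump 1 s.-1); rewrite ?p1; lia.
- by rewrite !inE; lia.
Qed.

Lemma classification_cardB2 : #|P1| = (n - 2)%N ->
  [/\ forall O : {set 'cV['F_2]_n}, O \in nontrivial_orbits e <->
         O = UT e (odds k) \/
         exists2 j, (1 <= j <= (n - 1)./2)%N & O = UT e (pred1 (2 * j)%N),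
      #|orbits e| = (uphalf n).+1
    & MS e = 1%N <->
        (exists2 l, l \in odds k & l \in Iset e) /\
        (forall j, (1 <= j <= n./2)%N -> (2 * j)%N \in Iset e)].
Proof.
move=> pB2; have odd_n : odd n by move: P1_odd; rewrite pB2; lia.
pose T i : {pred nat} := if i == 1%N then [in odds k] else pred1 (2 * i.-1)%N.
(* Number 1 is taken by the odd sizes, so a positive even size 2j gets j + 1, while 0 keeps 0. *)
pose cls s := if odd s then 1%N else (s./2 + (0 < s))%N.
have orb_odd s : (s <= n)%N -> odd s -> orb e (phi (init s)) = orb e (phi (init 1)).
  have [m] := ubnP s; elim: m s => // m IH s lt_s le_s odd_s.
  have [->//|neq_s1] := eqVneq s 1%N; rewrite -(IH (s - 2)%N); try lia.
  (* Two indices lie outside [P1]; complementing both of them away lowers the size by 2. *)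
  by apply: (@orb_size_jump (s - 2) 2); rewrite ?pB2; lia.
have [s|s|i|a b|s t|i s|orbE cardE MSE] := @size_classification cls _ _ _ _ _ T.
- by rewrite /cls; case: ifP; lia.
- by rewrite /cls; case: ifP; lia.
- case: i => [|[|j]] le_i; [by exists 0%N | by exists 1%N |].
  by exists j.+1.*2; rewrite /cls; [|case: ifP]; lia.
- by rewrite pB2 /cls; do 2!case: ifP; lia.
- move=> le_s le_t; rewrite /cls.
  case: ifPn => odd_s; case: ifPn => odd_t eq_st;
    [by rewrite !orb_odd | | |]; by rewrite (_ : s = t) //; lia.
- rewrite /T /cls; case: eqP => [->|i1] i_rng le_s; rewrite !inE; case: ifP; lia.
split=> // [O|].
  rewrite orbE; split=> [[i i_rng ->]|[->|[j j_rng ->]]].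
  - rewrite /T; case: eqP => i1; [by left | right; exists i.-1 => //; lia].
  - by exists 1%N.
  - by exists j.+1; [lia | rewrite /T; case: eqP => //; lia].
rewrite MSE; split=> [TI | [[l l_odd lI] evI] i i_rng].
  split=> [|j j_rng]; first by have [|l] := TI 1%N; [lia | exists l].
  by have [|l] := TI j.+1; [lia | rewrite /T; case: eqP => [|_]; [lia | rewrite inE => /eqP ->]].
rewrite /T; case: eqP => i1; first by exists l.
by exists (2 * i.-1)%N; [rewrite inE | apply: evI; lia].
Qed.

Lemma classification_cardB1 : #|P1| = (n - 1)%N ->
  [/\ forall O : {set 'cV['F_2]_n}, O \in nontrivial_orbits e <->
         exists2 i, (1 <= i <= uphalf n)%N & O = UT e (pred2 (2 * i - 1) (2 * i))%N,
      #|orbits e| = (uphalf n).+1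
    & MS e = 1%N <-> forall i, (1 <= i <= uphalf n)%N ->
                       exists2 l, l \in pred2 (2 * i - 1)%N (2 * i)%N & l \in Iset e].
Proof.
move=> pB1; have even_n : ~~ odd n by move: P1_odd; rewrite pB1; lia.
apply: (@size_classification uphalf) => [s|s|i|a b|s t|i s].
- lia.
- lia.
- by move=> le_i; exists (2 * i - 1)%N; lia.
- by rewrite pB1; lia.
- move=> le_s le_t eq_st; have [->//|neq_st] := eqVneq s t.
  (* A single index lies outside [P1], and the jump adds or removes it: t is s + 1 for s odd and s -
     1 for s even. *)
  have [odd_s|even_s] := boolP (odd s).
    by apply: (@orb_size_jump s 0); rewrite ?pB1; lia.
  by apply: (@orb_size_jump t 1); rewrite ?pB1; lia.
- by rewrite !inE; lia.
Qed.

End Coordinates.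

Theorem theorem5p4 (k : nat) (e : rel 'I_k.+2) :
  let n := k.+2 in
  symmetric e -> irreflexive e -> connected_graph e -> induced_path e ->
  odd #|Pi1 e| ->
  [\/ #|Pi1 e| = 1, #|Pi1 e| = n - 2 | #|Pi1 e| = n - 1] ->
  [/\ [/\ #|Pi1 e| = 1 ->
            forall O : {set 'cV['F_2]_n},
              O \in nontrivial_orbits e <->
              exists2 i, 1 <= i <= uphalf n & O = UT e (pred2 i (n + 1 - i)),
          #|Pi1 e| = n - 2 ->
            forall O : {set 'cV['F_2]_n},
              O \in nontrivial_orbits e <->
              O = UT e (odds k) \/
              (exists2 j, 1 <= j <= (n - 1)./2 & O = UT e (pred1 (2 * j)))
        & #|Pi1 e| = n - 1 ->
            forall O : {set 'cV['F_2]_n},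
              O \in nontrivial_orbits e <->
              exists2 i, 1 <= i <= uphalf n &
                O = UT e (pred2 (2 * i - 1) (2 * i))],
      [/\ #|Pi1 e| = 1 -> #|orbits e| = uphalf (n + 2),
          #|Pi1 e| = n - 2 -> 2 * #|orbits e| = n + 3
        & #|Pi1 e| = n - 1 -> 2 * #|orbits e| = n + 2],
      MS e <= 2
    & [/\ #|Pi1 e| = 1 ->
            (MS e = 1 <->
             forall i, 1 <= i <= uphalf n ->
               exists2 l, l \in pred2 i (n + 1 - i) & l \in Iset e),
          #|Pi1 e| = n - 2 ->
            (MS e = 1 <->
             (exists2 l, l \in odds k & l \in Iset e) /\
             (forall j, 1 <= j <= n./2 -> 2 * j \in Iset e))
        & #|Pi1 e| = n - 1 ->
            (MS e = 1 <->
             forall i, 1 <= i <= uphalf n ->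
               exists2 l, l \in pred2 (2 * i - 1) (2 * i) & l \in Iset e)]].
Proof.
move=> n e_sym e_irr _ e_path; rewrite /n card_Pi1 // => P1_odd _.
have case1 := classification_card1 e_sym e_irr e_path P1_odd.
have caseB2 := classification_cardB2 e_sym e_irr e_path P1_odd.
have caseB1 := classification_cardB1 e_sym e_irr e_path P1_odd.
split; last 1 first.
- by split=> [/case1[]|/caseB2[]|/caseB1[]].
- by split=> [/case1[]|/caseB2[]|/caseB1[]].
- split=> [/case1[_ -> _]|pB2|pB1]; first by lia.
    (* Oddness of #|P1| fixes the parity of n, which turns [uphalf n] into an exact half. *)
    by case: (caseB2 pB2) => _ -> _; move: P1_odd; rewrite pB2; lia.
  by case: (caseB1 pB1) => _ -> _; move: P1_odd; rewrite pB1; lia.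
- exact: MS_le2.
Qed.
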